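(* The category $\mathcal{S}_0$ (subcartesian spaces defined by atlases) is isomorphic to the category of subcartesian spaces (defined as differential spaces, with functionally smooth maps).
   Context: The category $\mathcal{S}_0$. Let $S$ be a Hausdorff, paracompact, second-countable topological space locally homeomorphic to subspaces of $\mathbb{R}^n$ ($n=0,1,\dots$): every $x\in S$ has an open neighbourhood $U$ and a homeomorphism (chart) $\varphi:U\to\tilde U$ onto a (not necessarily open) subset $\tilde U\subseteq\mathbb{R}^n$, for some $n$ (which may depend on the chart). Charts $\varphi:U\to\tilde U\subseteq\mathbb{R}^m$ and $\psi:V\to\tilde V\subseteq\mathbb{R}^n$ are compatible if for every $x\in U\cap V$ there are open neighbourhoods $W^\varphi\subseteq\mathbb{R}^m$ of $\varphi(x)$ and $W^\psi\subseteq\mathbb{R}^n$ of $\psi(x)$ and smooth maps $\zeta\in C^\infty(\mathbb{R}^m,\mathbb{R}^n)$, $\xi\in C^\infty(\mathbb{R}^n,\mathbb{R}^m)$ with $\zeta=\psi\circ\varphi^{-1}$ on $\varphi(U\cap V)\cap W^\varphi$ and $\xi=\varphi\circ\psi^{-1}$ on $\psi(U\cap V)\cap W^\psi$. A (maximal) atlas on $S$ is a maximal collection of pairwise compatible charts on $S$ (covering $S$). Objects of $\mathcal{S}_0$ are such spaces $S$ equipped with an atlas $\mathcal{A}$. A morphism $F:R\to S$ in $\mathcal{S}_0$ is a continuous map such that for every $x\in R$ there are a chart $\varphi:U\to\tilde U\subseteq\mathbb{R}^m$ about $x$ and a chart $\psi:V\to\tilde V\subseteq\mathbb{R}^n$ about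 $F(x)$ (in the given atlases) such that $\psi\circ F\circ\varphi^{-1}:\tilde U\to\tilde V$ extends to a smooth map $\mathbb{R}^m\to\mathbb{R}^n$. The category of subcartesian spaces. A differential structure on a nonempty set $X$ is a nonempty family $\mathcal{F}$ of functions $X\to\mathbb{R}$, together with the weakest topology making every element of $\mathcal{F}$ continuous, such that: (1) $F(f_1,\dots,f_k)\in\mathcal{F}$ for $f_i\in\mathcal{F}$, $F\in C^\infty(\mathbb{R}^k)$; (2) if $f:X\to\mathbb{R}$ is such that every $x\in X$ has an open neighbourhood $U$ and $g\in\mathcal{F}$ with $f|_U=g|_U$, then $f\in\mathcal{F}$. A map $F:(X,\mathcal{F}_X)\to(Y,\mathcal{F}_Y)$ is functionally smooth if $F^*\mathcal{F}_Y\subseteq\mathcal{F}_X$; a diffeomorphism is a functionally smooth map with functionally smooth inverse. A subset $Y\subseteq X$ is a differential subspace with the subspace topology and the functions $f:Y\to\mathbb{R}$ such that every $x\in Y$ has an open neighbourhood $U\subseteq X$ and $\tilde f\in\mathcal{F}$ with $f|_{U\cap Y}=\tilde f|_{U\cap Y}$. A subcartesian space is a paracompact, second-countable, Hausdorff differential space $(S,C^\infty(S))$ such that every $x\in S$ has an open neighbourhood $U$, some $n\in\mathbb{N}$, and a diffeomorphism from $U$ onto a differential subspace of $\mathbb{R}^n$. Morphisms are functionally smooth maps.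
   Formalization: The spaces in the category S_0 are required to be nonempty, as differential spaces are by definition; otherwise the empty space would be an initial object of S_0, while the category of (nonempty) subcartesian spaces has none. *)

(* Defs.v *)
From HB Require Import structures.
From mathcomp Require Import all_boot all_order all_algebra.
From mathcomp Require Import all_classical all_reals all_analysis.

Set Implicit Arguments.
Unset Strict Implicit.
Unset Printing Implicit Defensive.

Import Order.TTheory GRing.Theory Num.Theory.
Import numFieldNormedType.Exports.

Local Open Scope classical_set_scope.
Local Open Scope ring_scope.

Record category := Category {
  obj :> Type;
  hom : obj -> obj -> Type;
  cid : forall a, hom a a;
  ccomp : forall a b c, hom b c -> hom a b -> hom a c;
  ccomp1f : forall a b (f : hom a b), ccomp (cid b) f = f;
  ccompf1 : forall a b (f : hom a b), ccomp f (cid a) = f;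
  ccompA : forall a b c d (h : hom c d) (g : hom b c) (f : hom a b),
    ccomp h (ccomp g f) = ccomp (ccomp h g) f }.

Arguments cid {C} a : rename.
Arguments ccomp {C a b c} _ _ : rename.

Record functor (C D : category) := Functor {
  fobj :> C -> D;
  fmap : forall a b, hom a b -> hom (fobj a) (fobj b);
  fmap_id : forall a, fmap (cid a) = cid (fobj a);
  fmap_comp : forall a b c (g : hom b c) (f : hom a b),
    fmap (ccomp g f) = ccomp (fmap g) (fmap f) }.

Definition functor_id (C : category) : functor C C :=
  @Functor C C (fun a => a) (fun a b f => f) (fun a => erefl)
    (fun a b c g f => erefl).

Section FunctorComp.
Context {C D E : category} (G : functor D E) (F : functor C D).

Lemma functor_comp_id a : fmap G (fmap F (cid a)) = cid (G (F a)).
Proof. by rewrite (fmap_id F) (fmap_id G). Qed.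

Lemma functor_comp_comp a b c (g : hom b c) (f : hom a b) :
  fmap G (fmap F (ccomp g f)) =
  ccomp (fmap G (fmap F g)) (fmap G (fmap F f)).
Proof. by rewrite (fmap_comp F) (fmap_comp G). Qed.

Definition functor_comp : functor C E :=
  @Functor C E (fun a => G (F a)) (fun a b f => fmap G (fmap F f))
    functor_comp_id functor_comp_comp.

End FunctorComp.

(** Leibniz equality of functors: isomorphism, not merely equivalence. *)
Definition isomorphic_categories (C D : category) : Prop :=
  exists (F : functor C D) (G : functor D C),
    functor_comp G F = functor_id C /\ functor_comp F G = functor_id D.

Lemma sig_eq (T : Type) (P : T -> Prop) (u v : {x | P x}) :
  sval u = sval v -> u = v.
Proof. by move: u v => [x p] [y q] /= e; subst y; congr exist. Qed.

Section ConcreteCategory.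
Context (O : Type) (T : O -> Type) (P : forall X Y, (T X -> T Y) -> Prop).
Context (P_id : forall X, P (@idfun (T X))).
Context (P_comp : forall X Y Z (g : T Y -> T Z) (f : T X -> T Y),
  P g -> P f -> P (g \o f)).

Let H X Y : Type := {f : T X -> T Y | P f}.
Let H_id X : H X X := exist _ idfun (P_id X).
Let H_comp X Y Z (g : H Y Z) (f : H X Y) : H X Z :=
  exist _ (sval g \o sval f) (P_comp (svalP g) (svalP f)).

Definition concrete_category : category :=
  @Category O H H_id H_comp
    (fun X Y f => sig_eq (erefl : sval (H_comp (H_id Y) f) = sval f))
    (fun X Y f => sig_eq (erefl : sval (H_comp f (H_id X)) = sval f))
    (fun X Y Z W h g f => sig_eq
      (erefl : sval (H_comp h (H_comp g f)) = sval (H_comp (H_comp h g) f))).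

End ConcreteCategory.
Arguments concrete_category {O} T {P} _ _.

Section Smooth.
Context {R : realType}.
Implicit Types V W : normedModType R.

(** [f] is of class C^(k+1) iff it is (Frechet) differentiable and its
    derivative [x |-> 'd f x], with values in the linear maps, is of class C^k;
    for finite-dimensional [V] the latter can be tested on each vector [v]. *)
Fixpoint Ck V W (k : nat) (f : V -> W) : Prop :=
  if k is j.+1 then
    (forall x, differentiable f x) /\ (forall v, Ck j ('D_v f))
  else continuous f.

Definition smooth V W (f : V -> W) : Prop := forall k, Ck k f.

Lemma CkW V W k (f : V -> W) : Ck k.+1 f -> Ck k f.
Proof.
elim: k f => [f [df _] x|k IH f [df Df]].
  exact: differentiable_continuous.
by split=> // v; apply: IH.
Qed.

Lemma Ck_cst V W k (w : W) : Ck k (cst w : V -> W).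
Proof.
elim: k w => [w|k IH w] /=; first exact: cst_continuous.
split=> [x|v]; first exact: differentiable_cst.
rewrite (_ : 'D_v _ = cst 0); first exact: IH.
by apply/funext => x; rewrite derive_cst.
Qed.

Lemma CkD V W k (f g : V -> W) : Ck k f -> Ck k g -> Ck k (f \+ g).
Proof.
elim: k f g => [f g cf cg x|k IH f g [df Df] [dg Dg]].
  by apply: continuousD; [exact: cf|exact: cg].
split=> [x|v]; first exact: differentiableD.
rewrite (_ : 'D_v _ = 'D_v f \+ 'D_v g); first exact: (IH _ _ (Df v) (Dg v)).
by apply/funext => x; rewrite deriveD//; exact: diff_derivable.
Qed.

Lemma Ck_sum V W k n (f : 'I_n -> V -> W) :
  (forall i, Ck k (f i)) -> Ck k (fun x => \sum_(i < n) f i x).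
Proof.
elim: n f => [f _|n IH f Hf].
  rewrite (_ : (fun _ => _) = cst 0); first exact: Ck_cst.
  by apply/funext => x; rewrite big_ord0.
rewrite (_ : (fun _ => _) =
  (fun x => \sum_(i < n) f (widen_ord (leqnSn n) i) x) \+ f ord_max).
  by apply: CkD => //; apply: IH.
by apply/funext => x; rewrite big_ord_recr.
Qed.

Lemma CkM V k (f g : V -> R) : Ck k f -> Ck k g -> Ck k (f \* g).
Proof.
elim: k f g => [f g cf cg x|k IH f g cf cg].
  by apply: continuousM; [exact: cf|exact: cg].
have [df Df] := cf; have [dg Dg] := cg.
split=> [x|v]; first exact: differentiableM.
rewrite (_ : 'D_v _ = (f \* 'D_v g) \+ (g \* 'D_v f)).
  by apply: CkD; [exact: IH (CkW cf) (Dg v)|exact: IH (CkW cg) (Df v)].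
by apply/funext => x; rewrite deriveM//; exact: diff_derivable.
Qed.

Lemma Ck_linear V W W' k (L : {linear W -> W'}) (f : V -> W) :
  continuous L -> Ck k f -> Ck k (L \o f).
Proof.
move=> cL; elim: k f => [f cf x|k IH f [df Df]].
  by apply: continuous_comp; [exact: cf|exact: cL].
split=> [x|v].
  by apply: differentiable_comp => //; exact: linear_differentiable.
rewrite (_ : 'D_v _ = L \o 'D_v f); first exact: IH (Df v).
apply/funext => x; have dL : differentiable L (f x) by exact: linear_differentiable.
have dLf : differentiable (L \o f) x by exact: differentiable_comp.
by rewrite (deriveE v dLf) (diff_comp (df x) dL) /= (diff_lin _ cL) deriveE.
Qed.

Lemma Ck_id V k : Ck k (@idfun V).
Proof.
case: k => [|k] /=; first by move=> x; exact: cvg_id.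
split=> [x|v]; first exact: ex_diff.
rewrite (_ : 'D_v _ = cst v); first exact: Ck_cst.
by apply/funext => x; rewrite derive_id.
Qed.

Lemma Ck_coord V k n (f : V -> 'rV[R]_n) (i : 'I_n) :
  Ck k f -> Ck k (fun x => f x ord0 i).
Proof.
move=> Cf.
pose coord (N : 'rV[R]_n) : R := N ord0 i.
have coordL : linear coord by move=> a M N; rewrite /coord !mxE.
pose coordM := GRing.isLinear.Build _ _ _ _ coord coordL.
pose L : {linear 'rV[R]_n -> R} := HB.pack coord coordM.
apply: (@Ck_linear _ _ _ k L f _ Cf).
by move=> x; exact: coord_continuous.
Qed.

Lemma Ck_row V k n (f : V -> 'rV[R]_n) :
  (forall i, Ck k (fun x => f x ord0 i)) -> Ck k f.
Proof.
move=> Cf.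
rewrite (_ : f = fun x => \sum_(i < n) f x ord0 i *: delta_mx ord0 i).
  apply: Ck_sum => i.
  pose scal (t : R) : 'rV[R]_n := t *: delta_mx ord0 i.
  have scalL : linear scal by move=> a s t; rewrite /scal scalerDl scalerA.
  pose scalM := GRing.isLinear.Build _ _ _ _ scal scalL.
  pose L : {linear R -> 'rV[R]_n} := HB.pack scal scalM.
  apply: (@Ck_linear _ _ _ k L _ _ (Cf i)); exact: scalel_continuous.
by apply/funext => x; rewrite {1}[f x]row_sum_delta.
Qed.


Lemma derive_comp_row V W n (f : V -> 'rV[R]_n) (g : 'rV[R]_n -> W) v x :
  differentiable f x -> differentiable g (f x) ->
  'D_v (g \o f) x =
    \sum_(i < n) ('D_v f x) ord0 i *: 'D_(delta_mx ord0 i) g (f x).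
Proof.
move=> df dg.
have dgf : differentiable (g \o f) x by exact: differentiable_comp.
rewrite (deriveE v dgf) (diff_comp df dg) /=.
rewrite -(deriveE v df) {1}['D_v f x]row_sum_delta linear_sum.
by apply: eq_bigr => i _; rewrite linearZ /= -deriveE.
Qed.

Lemma Ck_compR V k n (f : V -> 'rV[R]_n) (g : 'rV[R]_n -> R) :
  Ck k f -> Ck k g -> Ck k (g \o f).
Proof.
elim: k f g => [f g cf cg x|k IH f g Cf Cg].
  by apply: continuous_comp; [exact: cf|exact: cg].
have [df Df] := Cf; have [dg Dg] := Cg.
split=> [x|v]; first exact: differentiable_comp.
rewrite (_ : 'D_v _ = fun x => \sum_(i < n)
    ((fun y => ('D_v f y) ord0 i) \* ('D_(delta_mx ord0 i) g \o f)) x).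
  apply: Ck_sum => i; apply: CkM; first exact: (Ck_coord i (Df v)).
  exact: IH (CkW Cf) (Dg _).
by apply/funext => x; rewrite derive_comp_row.
Qed.

Lemma smooth_comp V n p (f : V -> 'rV[R]_n) (g : 'rV[R]_n -> 'rV[R]_p) :
  smooth f -> smooth g -> smooth (g \o f).
Proof.
move=> sf sg k; apply: Ck_row => i.
exact: (Ck_compR (sf k) (Ck_coord i (sg k))).
Qed.

Lemma smooth_id V : smooth (@idfun V).
Proof. by move=> k; exact: Ck_id. Qed.

End Smooth.

Section Paracompact.
Context {T : topologicalType}.
Implicit Types U V : set (set T).

Definition open_covering U : Prop :=
  U `<=` open /\ \bigcup_(A in U) A = [set: T].

Definition locally_finite V : Prop :=
  forall x, exists2 W, open_nbhs x W &
    finite_set [set A | V A /\ A `&` W !=set0].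

Definition refines V U : Prop := forall A, V A -> exists2 B, U B & A `<=` B.

Definition paracompact : Prop := forall U, open_covering U ->
  exists V, [/\ open_covering V, refines V U & locally_finite V].

End Paracompact.
Arguments paracompact T : clear implicits.

Record admissible_space (T : topologicalType) : Prop := {
  admissible_nonempty : [set: T] !=set0;
  admissible_hausdorff : hausdorff_space T;
  admissible_paracompact : paracompact T;
  admissible_second_countable : @second_countable T }.

Section Charts.
Context {R : realType} {S : topologicalType}.

(** A chart is a partial map, represented by a total function; the value
    outside the domain is fixed to 0, so that two charts are equal as soon as
    they have the same domain and agree there. The target is the image
    [chart_map @` chart_dom]. *)
Record chart := Chart {
  chart_dim : nat;
  chart_dom : set S;
  chart_map :> S -> 'rV[R]_chart_dim;
  chart_open : open chart_dom;
  chart_continuous : {within chart_dom, continuous chart_map};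
  chart_inverse : exists2 g : 'rV[R]_chart_dim -> S,
    {within chart_map @` chart_dom, continuous g} &
    {in chart_dom, cancel chart_map g};
  chart_out : forall x, ~ chart_dom x -> chart_map x = 0 }.

(** [zeta = psi \o phi^-1] near [phi x], where [x] lies in both domains. *)
Definition transition_extends (phi psi : chart) (x : S)
    (zeta : 'rV[R]_(chart_dim phi) -> 'rV[R]_(chart_dim psi)) : Prop :=
  exists2 W, open_nbhs (phi x) W &
    forall y, chart_dom phi y -> chart_dom psi y -> W (phi y) ->
      zeta (phi y) = psi y.

Definition compatible (phi psi : chart) : Prop :=
  forall x, chart_dom phi x -> chart_dom psi x ->
    (exists2 zeta, smooth zeta & @transition_extends phi psi x zeta) /\
    (exists2 xi, smooth xi & @transition_extends psi phi x xi).

Definition pairwise_compatible (A : set chart) : Prop :=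
  forall phi psi, A phi -> A psi -> compatible phi psi.

Record is_atlas (A : set chart) : Prop := {
  atlas_compatible : pairwise_compatible A;
  atlas_covers : \bigcup_(phi in A) chart_dom phi = [set: S];
  atlas_maximal : forall B, pairwise_compatible B -> A `<=` B -> B = A }.

End Charts.
Arguments chart R S : clear implicits.

(** That the carrier is locally homeomorphic to subsets of R^n is
    [atlas_covers]. *)
Record atlas_space (R : realType) := AtlasSpace {
  atlas_carrier :> topologicalType;
  atlas : set (chart R atlas_carrier);
  atlas_admissible : admissible_space atlas_carrier;
  atlasP : is_atlas atlas }.
Arguments atlas {R} _.

Section AtlasMorphisms.
Context {R : realType}.
Implicit Types X Y Z : atlas_space R.

Record atlas_smooth X Y (F : X -> Y) : Prop := {
  atlas_smooth_continuous : continuous F;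
  atlas_smooth_local : forall x, exists phi psi,
    [/\ atlas X phi /\ chart_dom phi x,
        atlas Y psi /\ chart_dom psi (F x),
        F @` chart_dom phi `<=` chart_dom psi &
        exists2 zeta : 'rV[R]_(chart_dim phi) -> 'rV[R]_(chart_dim psi),
          smooth zeta &
          forall y, chart_dom phi y -> zeta (phi y) = psi (F y)] }.

Lemma compatible_refl (S : topologicalType) (phi : chart R S) :
  compatible phi phi.
Proof.
move=> x phix _; suff H : exists2 zeta, smooth zeta &
  @transition_extends _ _ phi phi x zeta by split.
exists idfun; first exact: smooth_id.
by exists setT => //; split => //; exact: openT.
Qed.

Lemma compatible_sym (S : topologicalType) (phi psi : chart R S) :
  compatible phi psi -> compatible psi phi.
Proof. by move=> c x psix phix; have [] := c x phix psix. Qed.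

Lemma atlas_mem X (phi : chart R X) :
  (forall psi, atlas X psi -> compatible phi psi) -> atlas X phi.
Proof.
move=> Hphi; have [pw _ max] := atlasP X.
rewrite -(max (atlas X `|` [set phi])); first by right.
  move=> c d [Ac|->] [Ad|->]; first exact: pw.
  - by apply: compatible_sym; exact: Hphi.
  - exact: Hphi.
  - exact: compatible_refl.
by move=> c; left.
Qed.

Section ChartRestrict.
Context {S : topologicalType} (phi : chart R S) (U : set S) (oU : open U).

Let D := chart_dom phi `&` U.
Let f := patch (fun=> 0) D phi.

Lemma chart_restrictE x : D x -> f x = phi x.
Proof. by move=> Dx; rewrite /f patchT// inE. Qed.

Lemma chart_restrict_open : open D.
Proof. by apply: openI => //; exact: chart_open. Qed.

Lemma chart_restrict_continuous : {within D, continuous f}.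
Proof.
have eqf : {in D, phi =1 f} by move=> x /set_mem Dx; rewrite chart_restrictE.
apply: (subspace_eq_continuous eqf).
by apply: continuous_subspaceW (@chart_continuous _ _ phi) => x [].
Qed.

Lemma chart_restrict_inverse : exists2 g : 'rV[R]_(chart_dim phi) -> S,
  {within f @` D, continuous g} & {in D, cancel f g}.
Proof.
have [g cg gK] := chart_inverse phi; exists g.
  apply: continuous_subspaceW cg => _ [x Dx <-].
  by exists x; [exact: Dx.1|rewrite chart_restrictE].
move=> x /set_mem Dx; rewrite chart_restrictE// gK//.
by apply/mem_set; exact: Dx.1.
Qed.

Lemma chart_restrict_out x : ~ D x -> f x = 0.
Proof. by move=> nDx; rewrite /f /patch memNset. Qed.

Definition chart_restrict : chart R S :=
  @Chart R S (chart_dim phi) D f chart_restrict_open chart_restrict_continuous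
    chart_restrict_inverse chart_restrict_out.

Lemma chart_restrict_compatible psi :
  compatible phi psi -> compatible chart_restrict psi.
Proof.
move=> c x Dx psix; have [[z sz [W Wx zW]] [z' sz' [W' Wx' zW']]] := c x Dx.1 psix.
split.
  exists z => //; exists W; first by rewrite /= chart_restrictE.
  move=> y Dy psiy; rewrite /= chart_restrictE// => Wy.
  by apply: zW => //; exact: Dy.1.
exists z' => //; exists W' => // y psiy Dy Wy.
by rewrite /= chart_restrictE//; apply: zW' => //; exact: Dy.1.
Qed.

End ChartRestrict.

Lemma atlas_restrict X (phi : chart R X) (U : set X) (oU : open U) :
  atlas X phi -> atlas X (chart_restrict phi oU).
Proof.
move=> Aphi; apply: atlas_mem => psi Apsi; apply: chart_restrict_compatible.
exact: (atlas_compatible (atlasP X)).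
Qed.

Lemma atlas_smooth_id X : atlas_smooth (@idfun X).
Proof.
split=> [x|x]; first exact: cvg_id.
have : [set: X] x by []; rewrite -(atlas_covers (atlasP X)) => -[phi Aphi phix].
exists phi, phi; split => //.
by exists idfun => //; exact: smooth_id.
Qed.

Lemma open_chart_preimage (S : topologicalType) (phi : chart R S)
  (W : set 'rV[R]_(chart_dim phi)) :
  open W -> open (chart_dom phi `&` phi @^-1` W).
Proof.
move=> oW; have /continuousP/(_ _ oW) := @chart_continuous _ _ phi.
by rewrite -(open_setIS _ (@chart_open _ _ phi)) setIC.
Qed.

Lemma atlas_smooth_comp X Y Z (G : Y -> Z) (F : X -> Y) :
  atlas_smooth G -> atlas_smooth F -> atlas_smooth (G \o F).
Proof.
move=> [cG lG] [cF lF]; split=> x.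
  by apply: continuous_comp; [exact: cF|exact: cG].
have [phi [psi [[Aphi phix] [Apsi psix] FD [z sz zE]]]] := lF x.
have [psi' [chi [[Apsi' psix'] [Achi chix] GD [w sw wE]]]] := lG (F x).
have [[t st [W [oW Wx] tE]] _] :=
  atlas_compatible (atlasP Y) Apsi Apsi' psix psix'.
pose V := chart_dom psi' `&` (chart_dom psi `&` psi @^-1` W).
have oV : open V by apply: openI; [exact: chart_open|exact: open_chart_preimage].
have oU : open (F @^-1` V) by move/continuousP : cF; apply.
exists (chart_restrict phi oU), chi; split=> //.
- by split; [exact: atlas_restrict|].
- by move=> _ [y [_ [psi'y _]] <-]; apply: GD; exists (F y).
- exists (w \o (t \o z)); first by do 2!apply: smooth_comp => //.
  move=> y [phiy [psi'y [psiy Wy]]] /=.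
  by rewrite chart_restrictE//= zE// tE// wE.
Qed.

Definition atlas_category : category :=
  concrete_category (fun X : atlas_space R => X : Type) atlas_smooth_id
    atlas_smooth_comp.

End AtlasMorphisms.
Arguments atlas_category R : clear implicits.

Section DifferentialStructures.
Context {R : realType}.

(** The coarsest topology making all the elements of [F] continuous, i.e. the
    supremum of the initial topologies of the elements of [F]. *)
Definition coarsest_open (X : choiceType) (F : set (X -> R)) : set (set X) :=
  @open (sup_topology (fun f : F =>
    Topological.class (initial_topology (\val f)))).

Record is_differential_structure (X : topologicalType) (F : set (X -> R))
    : Prop := {
  diff_nonempty : F !=set0;
  diff_topology : forall A : set X, open A <-> coarsest_open F A;
  diff_smooth : forall k (f : 'I_k -> X -> R) (G : 'rV[R]_k -> R),
    (forall i, F (f i)) -> smooth G -> F (fun x => G (\row_i f i x));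
  diff_local : forall f : X -> R,
    (forall x, exists U g, [/\ open_nbhs x U, F g & {in U, f =1 g}]) -> F f }.

Definition functionally_smooth (X Y : Type) (FX : set (X -> R))
    (FY : set (Y -> R)) (F : X -> Y) : Prop :=
  forall g, FY g -> FX (g \o F).

Definition diffeomorphism (X Y : Type) (FX : set (X -> R))
    (FY : set (Y -> R)) (F : X -> Y) : Prop :=
  functionally_smooth FX FY F /\
  exists G, [/\ cancel F G, cancel G F & functionally_smooth FY FX G].

Definition subspace_functions (X : topologicalType) (F : set (X -> R))
    (Y : set X) : set (Y -> R) :=
  [set f : Y -> R | forall x : Y, exists U g,
    [/\ open_nbhs (\val x) U, F g &
        forall y : Y, U (\val y) -> f y = g (\val y)]].

Definition smooth_functions n : set ('rV[R]_n -> R) := [set f | smooth f].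

Definition locally_euclidean_subspace (X : topologicalType)
    (F : set (X -> R)) : Prop :=
  forall x, exists2 U : set X, open_nbhs x U &
    exists n (Y : set 'rV[R]_n) (phi : U -> Y),
      diffeomorphism (subspace_functions F (Y := U))
        (subspace_functions (@smooth_functions n) (Y := Y)) phi.

End DifferentialStructures.

Record subcartesian_space (R : realType) := SubcartesianSpace {
  subcart_carrier :> topologicalType;
  subcart_functions : set (subcart_carrier -> R);
  subcart_admissible : admissible_space subcart_carrier;
  subcart_diff : is_differential_structure subcart_functions;
  subcart_local : locally_euclidean_subspace subcart_functions }.
Arguments subcart_functions {R} _.

Section SubcartesianMorphisms.
Context {R : realType}.
Implicit Types X Y Z : subcartesian_space R.

Definition subcart_smooth X Y (F : X -> Y) : Prop :=
  functionally_smooth (subcart_functions X) (subcart_functions Y) F.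

Lemma subcart_smooth_id X : subcart_smooth (@idfun X).
Proof. by []. Qed.

Lemma subcart_smooth_comp X Y Z (G : Y -> Z) (F : X -> Y) :
  subcart_smooth G -> subcart_smooth F -> subcart_smooth (G \o F).
Proof. by move=> sG sF g /sG /sF. Qed.

Definition subcartesian_category : category :=
  concrete_category (fun X : subcartesian_space R => X : Type)
    subcart_smooth_id subcart_smooth_comp.

End SubcartesianMorphisms.
Arguments subcartesian_category R : clear implicits.

(* Main.v *)
From mathcomp Require Import all_boot all_order all_algebra.
From mathcomp Require Import all_classical all_reals all_analysis.
From mathcomp Require Import ring lra.
Require Import Defs.

(** Both kinds of structure live on one and the same topological space, and
    each is recoverable from the other, so the isomorphism leaves carriers and
    underlying maps alone and only exchanges the structures:
    - an atlas yields the functions that near every point are a smooth function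
      of the coordinates of some chart ([chart_functions]);
    - a differential structure yields the charts whose coordinates are locally
      in it, and through which each of its functions factors smoothly near each
      point ([smooth_charts]).

    Almost everything is a computation with germs: the relation of factoring
    smoothly through a chart near a point is stable under smooth combinations
    and under change of charts, because finitely many neighbourhoods may be
    intersected and smooth maps compose. This gives the compatibility and the
    maximality of [smooth_charts C], and shows that a function which factors
    locally through such charts is in [C].

    Passing from germs to functions is the one place where a construction of
    analysis and the hypotheses on the space are needed. A coordinate of a chart
    is only defined on its domain, and must be shown to agree near a point with
    a global function of [chart_functions]: it is multiplied by a smooth cutoff
    ([exists_cutoff]). The image of a chart need not be locally closed in R^n,
    so the support of the cutoff, although closed in the domain of the chart,
    may fail to be closed in the space, and extension by zero may then be
    discontinuous. This is avoided by cutting off within a neighbourhood whose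
    closure lies in the domain; such a set exists because a paracompact
    Hausdorff space is regular ([paracompact_regular]). The resulting
    [chart_extension] also separates points from closed sets, so that the
    topology is the coarsest one for [chart_functions].

    In the other direction, a diffeomorphism from an open set onto a subspace of
    R^n is made into a chart ([diffeomorphism_smooth_chart]); its inverse is
    continuous because a map into a differential space is continuous as soon as
    its composites with the structure functions are
    ([cvg_differential_structure]).

    Both round trips are then identities of structures, the one on atlases by
    maximality. A map is a morphism for the atlases if and only if it is one for
    the functions ([atlas_smoothP]), which gives the functors. *)

Set Implicit Arguments.
Unset Strict Implicit.
Unset Printing Implicit Defensive.

Import Order.TTheory GRing.Theory Num.Theory.
Import numFieldNormedType.Exports.

Local Open Scope classical_set_scope.
Local Open Scope ring_scope.

(** * Smooth cutoff functions on R^n *)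

Section Bump.
Context {R : realType}.

(** The classical flat function [exp (- 1 / t)] is the case [n = 0]. The powers
    [t^-n] make the family stable under derivation, so that smoothness is a
    single induction on the order of differentiability. *)
Definition flat (n : nat) (t : R) : R :=
  if 0 < t then t^-1 ^+ n * expR (- t^-1) else 0.

Lemma flat_npos n t : t <= 0 -> flat n t = 0.
Proof. by move=> t0; rewrite /flat ltNge t0. Qed.

Lemma flat_pos n t : 0 < t -> flat n t = t^-1 ^+ n * expR (- t^-1).
Proof. by move=> t0; rewrite /flat t0. Qed.

Lemma flat_gt0 n t : 0 < t -> 0 < flat n t.
Proof.
by move=> t0; rewrite flat_pos// mulr_gt0 ?expR_gt0 ?exprn_gt0 ?invr_gt0.
Qed.

Lemma flat_ge0 n t : 0 <= flat n t.
Proof. by have [/flat_npos->//|/flat_gt0/ltW] := leP t 0. Qed.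

(** Bounding [expR t^-1] below by a single term of its series gives a quadratic
    bound, which makes the derivative at 0 vanish. *)
Lemma flat_le n t : flat n t <= n.+2`!%:R * t ^+ 2.
Proof.
have [t0|t0] := leP t 0.
  by rewrite flat_npos// mulr_ge0 ?sqr_ge0 ?ler0n.
have u0 : 0 < t^-1 by rewrite invr_gt0.
rewrite flat_pos// expRN ler_pdivrMr ?expR_gt0//.
have := expR_ge1Dxn n.+1 (ltW u0).
have F0 : 0 < n.+2`!%:R :> R by rewrite ltr0n fact_gt0.
move=> H; have {}H : t^-1 ^+ n.+2 / n.+2`!%:R <= expR t^-1 by lra.
apply: (le_trans _ (ler_wpM2l _ H)); last first.
  by rewrite mulr_ge0 ?sqr_ge0 ?ler0n.
rewrite !exprS expr0 mulr1 le_eqVlt; apply/orP; left; apply/eqP.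
field; by rewrite !gt_eqF.
Qed.

Lemma is_derive_flat n (t : R) :
  is_derive t 1 (flat n) (flat n.+2 t - n%:R * flat n.+1 t).
Proof.
have [t0|t0|->] := ltgtP t 0.
- rewrite !flat_npos ?ltW// mulr0 subr0.
  have E : \forall s \near t, cst 0 s = flat n s.
    near=> s; rewrite /= flat_npos// ltW//; near: s; exact: lt_nbhsl.
  exact: near_eq_is_derive E (is_derive_cst _ _ _).
- rewrite !flat_pos//.
  have E : \forall s \near t, s^-1 ^+ n * expR (- s^-1) = flat n s.
    near=> s; rewrite flat_pos//; near: s; exact: lt_nbhsr.
  apply: near_eq_is_derive E _.
  have tn0 : t != 0 by rewrite gt_eqF.
  have dV : is_derive t 1 (fun s : R => s^-1) (- t ^- 2).
    apply: is_derive_eq; first exact: (@is_deriveV _ idfun).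
    by rewrite /= /GRing.scale /= mulr1.
  have dE : is_derive t 1 (fun s : R => expR (- s^-1)) (expR (- t^-1) * t ^- 2).
    rewrite -[t ^- 2]opprK.
    by apply: (@is_derive1_comp _ expR (fun s : R => - s^-1)).
  have dX : is_derive t 1 (fun s : R => s^-1 ^+ n)
      ((n%:R * t^-1 ^+ n.-1) *: - t ^- 2).
    rewrite (_ : (fun _ => _) = (fun s : R => s^-1) ^+ n).
      exact: is_deriveX.
    by apply/funext => s; rewrite exprfctE.
  have dM := is_deriveM dX dE.
  rewrite (_ : _ * _ = fun s : R => s^-1 ^+ n * expR (- s^-1)) in dM;
    last by [].
  apply: is_derive_eq dM _.
  rewrite /GRing.scale /= -!exprVn; move: (t^-1) (expR _) => u E.
  by case: n {dX} => [|n] /=; rewrite !exprS ?mulr0n; ring.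
- rewrite !flat_npos// mulr0 subr0.
  have cv : h^-1 *: ((flat n \o shift 0) (h *: 1) - flat n 0)
      @[h --> (0 : R)^'] --> (0 : R).
    have le_C (h : R) : `|h^-1 *: ((flat n \o shift 0) (h *: 1) - flat n 0)|
        <= n.+2`!%:R * `|h|.
      rewrite /= /GRing.scale /= mulr1 addr0 (flat_npos _ (lexx 0)) subr0.
      have [->|h0] := eqVneq h 0; first by rewrite invr0 mul0r normr0 mulr0.
      rewrite normrM normfV ler_pdivrMl ?normr_gt0// mulrCA -expr2 -normrX.
      by rewrite !ger0_norm ?sqr_ge0 ?flat_ge0// flat_le.
    apply: norm_cvg0.
    apply: (@squeeze_cvgr _ _ _ _ (cst 0) (fun h : R => n.+2`!%:R * `|h|)).
    - by near=> h; apply/andP; split; [exact: normr_ge0|exact: le_C].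
    - exact: cvg_cst.
    - rewrite -[X in _ --> X](mulr0 n.+2`!%:R).
      apply: cvgM; first exact: cvg_cst.
      rewrite -[X in _ --> X](normr0 R); apply: cvg_norm.
      exact: (@cvg_within _ (nbhs (0 : R))).
  apply: DeriveDef; first by apply/cvg_ex; exists 0; exact: cv.
  exact: (cvg_lim _ cv).
Unshelve. all: by end_near.
Qed.

Lemma Ck_flat k n : Ck k (flat n).
Proof.
have D m t : differentiable (flat m) t.
  by apply/derivable1_diffP; have [] := is_derive_flat m t.
elim: k n => [|k IH] n /=; first by move=> t; exact: differentiable_continuous.
split=> // v.
rewrite (_ : 'D_v _ = cst v \* (flat n.+2 \+ (cst (- n%:R) \* flat n.+1))).
  apply: CkM; first exact: Ck_cst.
  by apply: CkD => //; apply: CkM => //; exact: Ck_cst.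
apply/funext => t /=; rewrite mulNr.
have := derive_val (is_derive := is_derive_flat n t); rewrite !deriveE// => <-.
by rewrite -[v in LHS]mulr1 -[v * 1]/(v *: 1) linearZ.
Qed.

(** The derivative of [f^-1] is a product of [- 'D_v f] and two copies of
    [f^-1], so the induction feeds on itself. *)
Lemma Ck_inv (V : normedModType R) k (f : V -> R) :
  (forall x, f x != 0) -> Ck k f -> Ck k (fun x => (f x)^-1).
Proof.
move=> f0; elim: k f f0 => [f f0 cf x|k IH f f0 cf].
  by apply: cvgV => //; exact: cf.
have [df Df] := cf; split=> [x|v]; first exact: differentiableV.
rewrite (_ : 'D_v _ = cst (-1) \*
    (((fun x => (f x)^-1) \* (fun x => (f x)^-1)) \* 'D_v f)).
  have H := IH _ f0 (CkW cf).
  exact: CkM (@Ck_cst _ _ _ _ _) (CkM (CkM H H) (Df v)).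
apply/funext => x /=; rewrite deriveV//; last exact: diff_derivable.
by rewrite /GRing.scale /= expr2 invfM mulN1r mulNr.
Qed.

Lemma Ck_comp1 (V : normedModType R) k (f : V -> R) (g : R -> R) :
  Ck k f -> Ck k g -> Ck k (g \o f).
Proof.
elim: k f g => [f g cf cg x|k IH f g cf cg].
  by apply: continuous_comp; [exact: cf|exact: cg].
have [df Df] := cf; have [dg Dg] := cg.
split=> [x|v]; first exact: differentiable_comp.
rewrite (_ : 'D_v _ = 'D_v f \* ('D_1 g \o f)).
  exact: CkM (Df v) (IH _ _ (CkW cf) (Dg 1)).
apply/funext => x /=.
have dgf : differentiable (g \o f) x by exact: differentiable_comp.
rewrite (deriveE v dgf) diff_comp//= !deriveE//.
by rewrite -['d f x v in LHS]mulr1 -['d f x v * 1]/('d f x v *: 1) linearZ.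
Qed.

(** The denominator never vanishes because [t] and [1 - t] are not both
    nonpositive. *)
Definition smoothstep (t : R) : R := flat 0 t * (flat 0 t + flat 0 (1 - t))^-1.

Lemma smoothstep_den_gt0 t : 0 < flat 0 t + flat 0 (1 - t).
Proof.
have [t0|t0] := ltP 0 t; first by rewrite ltr_pwDl ?flat_gt0 ?flat_ge0.
by rewrite ltr_wpDl ?flat_ge0// flat_gt0//; lra.
Qed.

Lemma smoothstep_smooth : smooth smoothstep.
Proof.
move=> k; apply: CkM; first exact: Ck_flat.
apply: Ck_inv => [t|]; first by rewrite gt_eqF ?smoothstep_den_gt0.
apply: CkD; first exact: Ck_flat.
apply: (Ck_comp1 (g := flat 0) _ (Ck_flat _ _)).
rewrite (_ : (fun _ => _) = cst 1 \+ (cst (-1) \* idfun)).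
  by apply: CkD; [exact: Ck_cst|apply: CkM; [exact: Ck_cst|exact: Ck_id]].
by apply/funext => t /=; rewrite mulN1r.
Qed.

Lemma smoothstep0 t : t <= 0 -> smoothstep t = 0.
Proof. by move=> t0; rewrite /smoothstep flat_npos// mul0r. Qed.

Lemma smoothstep1 t : 1 <= t -> smoothstep t = 1.
Proof.
move=> t1; rewrite /smoothstep [flat 0 (1 - t)]flat_npos ?subr_le0//.
rewrite addr0 divff//.
by rewrite gt_eqF// flat_gt0//; lra.
Qed.

(** The cutoff is a smooth step applied to a quadratic function of the distance
    to [p] that is 2 at [p]; the Euclidean norm is used because its square is
    smooth. *)
Lemma exists_cutoff n (p : 'rV[R]_n) (W : set 'rV[R]_n) : nbhs p W ->
  exists b : 'rV[R]_n -> R,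
    [/\ smooth b, \forall y \near p, b y = 1 & forall y, b y != 0 -> W y].
Proof.
move=> /nbhs_ballP[e /= e0 eW].
pose q (y : 'rV[R]_n) : R := \sum_(i < n) (y ord0 i - p ord0 i) ^+ 2.
(* With this constant the step vanishes as soon as [q y] reaches [e ^+ 2]. *)
pose c := 2 * e ^- 2.
have c0 : 0 < c by rewrite mulr_gt0// invr_gt0 exprn_gt0.
have sq : smooth (fun y => 2 - c * q y).
  move=> k; have Cd (i : 'I_n) : Ck k (fun y : 'rV[R]_n => y ord0 i - p ord0 i).
    apply: (@CkD _ _ _ k (fun y : 'rV[R]_n => y ord0 i) (cst (- p ord0 i))).
      exact: (Ck_coord i (@Ck_id _ 'rV[R]_n k)).
    exact: Ck_cst.
  rewrite (_ : (fun _ => _) = cst 2 \+ (cst (- c) \* q)); last first.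
    by apply/funext => y /=; rewrite mulNr.
  apply: CkD; first exact: Ck_cst.
  apply: CkM; first exact: Ck_cst.
  apply: Ck_sum => i; exact: (CkM (Cd i) (Cd i)).
exists (smoothstep \o (fun y => 2 - c * q y)); split.
- by move=> k; apply: Ck_comp1 (sq k) (smoothstep_smooth k).
- have cq := sq 0%N p.
  have q0 : q p = 0 by rewrite /q big1// => i _; rewrite subrr expr0n.
  have p1 : 1 < 2 - c * q p by rewrite q0; lra.
  have : \forall y \near p, 1 < 2 - c * q y by exact: cq (lt_nbhsr p1).
  by apply: filterS => y y1; rewrite /= smoothstep1// ltW.
- move=> y /= sy; apply: eW; suff H i : `|p ord0 i - y ord0 i| < e.
    by split=> // i j; rewrite ord1; exact: H.
  have : 0 < 2 - c * q y by rewrite ltNge; apply: contra sy => /smoothstep0 ->.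
  rewrite subr_gt0 /c -mulrA gtr_pMr// mulrC ltr_pdivrMr ?exprn_gt0// mul1r.
  move=> qe.
  rewrite -(@ltr_pXn2r _ 2) ?nnegrE ?normr_ge0 ?(ltW e0)//.
  rewrite -normrX ger0_norm ?sqr_ge0//; apply: le_lt_trans qe.
  rewrite /q (bigD1 i)//= -sqrrN opprB lerDl sumr_ge0// => j _.
  exact: sqr_ge0.
Qed.

End Bump.

(** * Topology: regularity and coarsest topologies *)

(** Given a neighbourhood [U] of [a], cover the space by the open sets that lie
    in [U] or whose closure avoids [a]. Near [a] only finitely many members of a
    locally finite refinement matter; removing the closures of those avoiding
    [a] leaves a neighbourhood of [a] whose closure stays in [U]. *)
Lemma paracompact_regular (T : topologicalType) :
  hausdorff_space T -> paracompact T -> regular_space T.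
Proof.
move=> hT pT a U aU.
pose C := [set A : set T | open A /\ (A `<=` U \/ ~ closure A a)].
have [|V [[oV cV] VC lfV]] := pT C.
  split=> [A []//|]; rewrite -subTset => x _.
  have [->|xa] := eqVneq x a.
    exists U^°; last exact: aU.
    by split; [exact: open_interior|left; exact: interior_subset].
  move: hT; rewrite open_hausdorff => /(_ _ _ xa)[[A B]] /= [xA aB] [oA oB AB].
  exists A; last by apply/set_mem; rewrite inE in xA; rewrite inE.
  split=> //; right=> /(_ B) [].
    by apply: open_nbhs_nbhs; split=> //; exact/set_mem.
  by move=> z; rewrite (eqP AB).
have [W aW finW] := lfV a.
pose bad := [set A | (V A /\ A `&` W !=set0) /\ ~ closure A a].
have fbad : finite_set bad by apply: sub_finite_set finW => A [].
have [F badF] := finite_fsetP.1 fbad.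
pose N := W `&` \bigcap_(A in bad) ~` closure A.
have aN : nbhs a N.
  apply: filterI; first exact: open_nbhs_nbhs.
  rewrite badF; apply: filter_bigI => A AF.
  have [_ naA] : bad A by rewrite badF.
  by apply: open_nbhs_nbhs; split=> //; exact/closed_openC/closed_closure.
exists N => // y yN; have : [set: T] y by [].
rewrite -cV => -[B VB yB].
have [A [_ AUa] BA] := VC _ VB.
have [z [[zW zN] zB]] : N `&` B !=set0.
  by apply: yN; apply: open_nbhs_nbhs; split => //; exact: oV.
have [AU|naA] := AUa; first exact: AU (BA _ yB).
have /zN : bad B.
  split; first by split=> //; exists z.
  by move=> aB; apply: naA; exact: closure_subset BA _ aB.
by case; exact: subset_closure.
Qed.

Section CoarsestTopology.
Context {R : realType}.

Lemma coarsest_open_preimage (X : choiceType) (C : set (X -> R)) f (O : set R) :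
  C f -> open O -> coarsest_open C (f @^-1` O).
Proof.
move=> Cf oO; pose f' : C := exist _ f (mem_set Cf).
rewrite /coarsest_open openE => x fx.
pose Tc := fun f : C => Topological.class (initial_topology (\val f)).
have [H _] := @cvg_sup X C Tc _ x (nbhs_filter (x : sup_topology Tc)).
apply: (H _ f'); first by move=> A.
by exists (f @^-1` O); split=> //; exists O.
Qed.

(** The functions of a differential structure detect convergence, since they
    induce the topology. *)
Lemma cvg_differential_structure (X : topologicalType) (C : set (X -> R))
    (F : set_system X) (x : X) :
  is_differential_structure C -> Filter F ->
  (forall f, C f -> f @ F --> f x) -> F --> x.
Proof.
move=> hC FF CF A; rewrite /= nbhsE => -[B [oB Bx] BA].
pose Tc := fun f : C => Topological.class (initial_topology (\val f)).
have [_] := @cvg_sup X C Tc F x FF.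
move=> cF; apply: (filterS BA); apply: cF.
  move=> f N [_ [[P oP <-] Px] PN].
  apply: (filterS PN); apply: (CF (\val f)); first exact/set_mem/(valP f).
  exact: open_nbhs_nbhs.
apply: open_nbhs_nbhs; split=> //; exact: (diff_topology hC B).1 oB.
Qed.

Lemma differential_continuous (X : topologicalType) (C : set (X -> R)) f :
  is_differential_structure C -> C f -> continuous f.
Proof.
move=> hC Cf; apply/continuousP => O oO.
exact/(diff_topology hC)/coarsest_open_preimage.
Qed.

Lemma coarsest_open_min (X : topologicalType) (C : set (X -> R)) A :
  (forall f, C f -> continuous f) -> coarsest_open C A -> open A.
Proof.
move=> Ccont oA.
rewrite openE => x Ax.
pose Tc := fun f : C => Topological.class (initial_topology (\val f)).
have [_ cx] := @cvg_sup X C Tc (nbhs x) x _.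
have : nbhs (x : sup_topology Tc) A by exact: open_nbhs_nbhs.
apply: cx => f N [_ [[P oP <-] Px] PN].
apply: (filterS PN); apply: (Ccont _ (set_mem (valP f))).
exact: open_nbhs_nbhs.
Qed.

Lemma coarsest_open_separating (X : choiceType) (C : set (X -> R)) (A : set X) :
  (forall x, A x -> exists f, [/\ C f, f x != 0 & forall y, f y != 0 -> A y]) ->
  coarsest_open C A.
Proof.
move=> sep.
pose N (f : X -> R) := f @^-1` [set t | t != 0].
rewrite (_ : A = \bigcup_(f in [set f | C f /\ N f `<=` A]) N f).
  by apply: bigcup_open => f [Cf _]; apply: coarsest_open_preimage.
apply/seteqP; split=> [x Ax|x [f [_ fA] /fA//]].
by have [f [Cf fx fA]] := sep x Ax; exists f.
Qed.

End CoarsestTopology.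

(** * Germs of functions in charts *)

Lemma choice2 (I T : Type) (P Q : I -> T -> Prop) :
  (forall i, exists2 t, P i t & Q i t) ->
  exists g, (forall i, P i (g i)) /\ (forall i, Q i (g i)).
Proof.
move=> PQ; have /choice[g gP] i : exists t, P i t /\ Q i t.
  by have [t] := PQ i; exists t.
by exists g; split=> i; [exact: (gP i).1|exact: (gP i).2].
Qed.

Section SmoothRow.
Context {R : realType}.

Lemma smooth_row (V : normedModType R) n (g : 'I_n -> V -> R) :
  (forall i, smooth (g i)) -> smooth (fun x => \row_i g i x).
Proof.
move=> sg k; apply: Ck_row => i.
rewrite (_ : (fun _ => _) = g i); first exact: sg.
by apply/funext => x; rewrite mxE.
Qed.

Lemma smooth_coord n (i : 'I_n) : smooth (fun p : 'rV[R]_n => p ord0 i).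
Proof. by move=> k; exact: Ck_coord i (Ck_id _ k). Qed.

Lemma smooth_compR (V : normedModType R) n (f : V -> 'rV[R]_n)
    (g : 'rV[R]_n -> R) :
  smooth f -> smooth g -> smooth (g \o f).
Proof. by move=> sf sg k; exact: Ck_compR. Qed.

Lemma smooth_cst (V : normedModType R) (c : R) : smooth (cst c : V -> R).
Proof. by move=> k; exact: Ck_cst. Qed.

Lemma row_coord n (p : 'rV[R]_n) : \row_i p ord0 i = p.
Proof. by apply/rowP => i; rewrite mxE. Qed.

End SmoothRow.

Section ChartGerms.
Context {R : realType} {S : topologicalType}.
Implicit Types (phi psi : chart R S) (f : S -> R) (x : S).

Lemma near_chart phi x (W : set 'rV[R]_(chart_dim phi)) :
  chart_dom phi x -> nbhs (phi x) W -> \forall y \near x, W (phi y).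
Proof.
move=> phix.
move=> /((subspace_continuousP _ _).1 (@chart_continuous _ _ phi) _ phix) W'.
have {}W' : \forall y \near x, chart_dom phi y -> W (phi y) by exact: W'.
by apply: filterS2 W' (open_nbhs_nbhs (conj (chart_open phi) phix)) => y H /H.
Qed.

Lemma near_chart_dom phi x :
  chart_dom phi x -> \forall y \near x, chart_dom phi y.
Proof. by move=> phix; exact: open_nbhs_nbhs (conj (chart_open phi) phix). Qed.

(** A chart is a homeomorphism onto its image, so neighbourhoods in the space
    are cut out by neighbourhoods in R^n. *)
Lemma chart_image_nbhs phi x (V : set S) : chart_dom phi x -> nbhs x V ->
  exists2 W, open_nbhs (phi x) W &
    forall y, chart_dom phi y -> W (phi y) -> V y.
Proof.
move=> phix xV; have [g /subspace_continuousP cg gK] := chart_inverse phi.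
have gx : g (phi x) = x by apply: gK; exact: mem_set.
have : nbhs (g (phi x)) V by rewrite gx.
move=> /(cg (phi x)); rewrite /= /within/= => /(_ (ex_intro2 _ _ x phix erefl)).
rewrite nbhs_simpl /= nbhsE => -[W oW WV]; exists W => // y phiy Wy.
by rewrite -(gK y) ?inE//; apply: WV => //; exists y.
Qed.

Lemma transition_extendsP phi psi x zeta :
  chart_dom phi x -> chart_dom psi x ->
  transition_extends (phi := phi) (psi := psi) x zeta <->
  \forall y \near x, zeta (phi y) = psi y.
Proof.
move=> phix psix; split=> [[W oW zE]|/(chart_image_nbhs phix)[W oW zE]].
  have := near_chart phix (open_nbhs_nbhs oW).
  apply: filterS3 (near_chart_dom phix) (near_chart_dom psix) => y.
  exact: zE.
by exists W => // y phiy _; exact: zE.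
Qed.

Definition factors_near f phi x :=
  exists2 g : 'rV[R]_(chart_dim phi) -> R, smooth g &
    \forall y \near x, f y = g (phi y).

Definition locally_in (C : set (S -> R)) f x :=
  exists2 g, C g & \forall y \near x, f y = g y.

Lemma factors_near_row k (f : 'I_k -> S -> R) phi x :
  (forall i, factors_near (f i) phi x) ->
  exists2 z : 'rV[R]_(chart_dim phi) -> 'rV[R]_k, smooth z &
    \forall y \near x, \row_i f i y = z (phi y).
Proof.
move=> /choice2[g [sg fg]].
exists (fun p => \row_i g i p); first exact: smooth_row.
have : \forall y \near x, forall i, f i y = g i (phi y).
  exact: filter_forall.
by apply: filterS => y fy; apply/rowP => i; rewrite !mxE.
Qed.

Lemma factors_near_comp k (f : 'I_k -> S -> R) (G : 'rV[R]_k -> R) phi x :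
  (forall i, factors_near (f i) phi x) -> smooth G ->
  factors_near (fun y => G (\row_i f i y)) phi x.
Proof.
move=> /factors_near_row[z sz fz] sG.
exists (G \o z); first exact: smooth_compR.
by apply: filterS fz => y /= ->.
Qed.

Lemma factors_near_trans f phi psi x : factors_near f phi x ->
  (forall i, factors_near (fun y => phi y ord0 i) psi x) ->
  factors_near f psi x.
Proof.
move=> [g sg fE] /factors_near_comp/(_ sg)[h sh hE]; exists h => //.
by apply: filterS2 fE hE => y -> <-; rewrite row_coord.
Qed.

(** Compatibility is a condition on the coordinate functions alone, as extending
    a transition map is the same as extending each of its components. *)
Lemma compatibleP phi psi : compatible phi psi <->
  forall x, chart_dom phi x -> chart_dom psi x ->
    (forall i, factors_near (fun y => psi y ord0 i) phi x) /\
    (forall i, factors_near (fun y => phi y ord0 i) psi x).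
Proof.
have toF (a b : chart R S) x : chart_dom a x -> chart_dom b x ->
    (exists2 z, smooth z & @transition_extends R S a b x z) <->
    (forall i, factors_near (fun y => b y ord0 i) a x).
  move=> ax bx; split=> [[z sz /(transition_extendsP _ ax bx) zE] i|ff].
    exists (fun p => z p ord0 i); first by move=> k; exact: Ck_coord.
    by apply: filterS zE => y ->.
  have [z sz zE] := factors_near_row ff; exists z => //.
  apply/(transition_extendsP _ ax bx).
  by apply: filterS zE => y <-; rewrite row_coord.
split=> c x phix psix; have [c1 c2] := c x phix psix.
  by split; [apply/toF|apply/toF].
by split; apply/toF.
Qed.

Lemma locally_in_factors (C : set (S -> R)) f phi x :
  locally_in C f x -> (forall g, C g -> factors_near g phi x) ->
  factors_near f phi x.
Proof.
move=> [g Cg fg] /(_ g Cg)[h sh gh]; exists h => //.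
by apply: filterS2 fg gh => y -> ->.
Qed.

(** These are the diffeomorphisms from open sets onto subspaces of R^n, in a
    form that speaks of germs only: the two conditions say that the chart and
    its inverse are smooth. *)
Definition smooth_charts (C : set (S -> R)) : set (chart R S) :=
  [set phi | forall x, chart_dom phi x ->
    (forall i, locally_in C (fun y => phi y ord0 i) x) /\
    (forall f, C f -> factors_near f phi x)].

Definition chart_functions (A : set (chart R S)) : set (S -> R) :=
  [set f | forall x,
    exists2 phi, A phi /\ chart_dom phi x & factors_near f phi x].

End ChartGerms.

Section SmoothCharts.
Context {R : realType} {S : topologicalType} (C : set (S -> R)).
Hypothesis hC : is_differential_structure C.

Lemma differential_locally f : (forall x, locally_in C f x) -> C f.
Proof.
move=> lf; apply: (diff_local hC) => x; have [g Cg fg] := lf x.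
have : nbhs x [set y | f y = g y] by exact: fg.
rewrite nbhsE => -[U oU UE]; exists U, g; split=> // y.
by rewrite inE; exact: UE.
Qed.

Lemma locally_in_comp k (f : 'I_k -> S -> R) (G : 'rV[R]_k -> R) x :
  (forall i, locally_in C (f i) x) -> smooth G ->
  locally_in C (fun y => G (\row_i f i y)) x.
Proof.
move=> /choice2[g [Cg fg]] sG.
exists (fun y => G (\row_i g i y)); first exact: (diff_smooth hC).
have : \forall y \near x, forall i, f i y = g i y by exact: filter_forall.
by apply: filterS => y fy /=; congr G; apply/rowP => i; rewrite !mxE.
Qed.

Lemma factors_near_locally f phi x : factors_near f phi x ->
  (forall i, locally_in C (fun y => phi y ord0 i) x) -> locally_in C f x.
Proof.
move=> [g sg fE] /locally_in_comp/(_ sg)[h Ch hE]; exists h => //.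
by apply: filterS2 fE hE => y -> <-; rewrite row_coord.
Qed.

Lemma smooth_charts_compatible : pairwise_compatible (smooth_charts C).
Proof.
move=> phi psi sphi spsi; apply/compatibleP => x phix psix.
have [l1 f1] := sphi x phix; have [l2 f2] := spsi x psix.
by split=> i; apply: locally_in_factors;
  [exact: l2|exact: f1|exact: l1|exact: f2].
Qed.

(** A chart [psi] compatible with some smooth chart [phi] around each point is
    itself smooth: the transition maps carry both conditions from [phi] to
    [psi]. *)
Lemma smooth_charts_maximal :
  \bigcup_(phi in smooth_charts C) chart_dom phi = [set: S] ->
  forall B, pairwise_compatible B -> smooth_charts C `<=` B ->
    B = smooth_charts C.
Proof.
move=> cov B pB CB; apply/seteqP; split=> // psi Bpsi x psix.
have : [set: S] x by []; rewrite -cov => -[phi sphi phix].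
have [lphi fphi] := sphi x phix.
have [psi_phi phi_psi] :=
  (compatibleP _ _).1 (pB _ _ (CB _ sphi) Bpsi) x phix psix.
split=> [i|f Cf]; first exact: factors_near_locally (psi_phi i) lphi.
exact: factors_near_trans (fphi f Cf) phi_psi.
Qed.

Lemma chart_functions_smooth_charts :
  \bigcup_(phi in smooth_charts C) chart_dom phi = [set: S] ->
  chart_functions (smooth_charts C) = C.
Proof.
move=> cov; apply/seteqP; split=> f.
  move=> Hf; apply: differential_locally => x.
  have [phi [sphi phix] ff] := Hf x.
  exact: factors_near_locally ff (sphi x phix).1.
move=> Cf x; have : [set: S] x by []; rewrite -cov => -[phi sphi phix].
by exists phi => //; apply: (sphi x phix).2.
Qed.

End SmoothCharts.

(** * From atlases to differential structures *)

Section AtlasFunctions.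
Context {R : realType} {S : topologicalType} (A : set (chart R S)).
Hypotheses (hA : is_atlas A) (hS : admissible_space S).

Local Notation C := (chart_functions A).

Lemma chart_functions_factor f phi x :
  C f -> A phi -> chart_dom phi x -> factors_near f phi x.
Proof.
move=> Cf Aphi phix; have [psi [Apsi psix] ff] := Cf x.
apply: factors_near_trans ff _.
exact: ((compatibleP _ _).1 (atlas_compatible hA Aphi Apsi) x phix psix).1.
Qed.

Lemma atlas_chart_at x : exists2 phi, A phi & chart_dom phi x.
Proof.
have : [set: S] x by []; rewrite -(atlas_covers hA) => -[phi Aphi phix].
by exists phi.
Qed.

Lemma factors_near_continuous (f : S -> R) phi x :
  chart_dom phi x -> factors_near f phi x -> {for x, continuous f}.
Proof.
move=> phix [g sg fg] N; rewrite /= (nbhs_singleton fg) => /(sg 0%N (phi x)) N'.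
by apply: filterS2 fg (near_chart phix N') => y /= ->.
Qed.

(** The function is cut off inside a set whose closure is contained in the
    domain of the chart, so that it vanishes near every point outside the
    domain; the support need not be closed in the space otherwise. *)
Lemma chart_extension (phi : chart R S) x (g : 'rV[R]_(chart_dim phi) -> R)
    (U : set S) :
  A phi -> chart_dom phi x -> nbhs x U -> smooth g ->
  exists f, [/\ C f, \forall y \near x, f y = g (phi y) &
    forall y, f y != 0 -> U y].
Proof.
move=> Aphi phix xU sg.
have := paracompact_regular
  (admissible_hausdorff hS) (admissible_paracompact hS).
move=> /(_ x _ (near_chart_dom phix))[V xV VD].
have [W xW WV] := chart_image_nbhs phix (filterI xU xV).
have [b [sb b1 bW]] := exists_cutoff (open_nbhs_nbhs xW).
pose f y := if `[< chart_dom phi y >] then b (phi y) * g (phi y) else 0.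
have fV y : f y != 0 -> U y /\ V y.
  rewrite /f; case: asboolP => [phiy|_]; last by rewrite eqxx.
  by rewrite mulf_eq0 negb_or => /andP[/bW Wb _]; exact: WV.
exists f; split=> [y||y /fV[]//].
  have [phiy|nphiy] := pselect (chart_dom phi y).
    exists phi => //; exists (b \* g); first by move=> k; exact: CkM.
    by apply: filterS (near_chart_dom phiy) => z phiz; rewrite /f asboolT.
  have [psi Apsi psiy] := atlas_chart_at y.
  exists psi => //; exists (cst 0); first exact: smooth_cst.
  have : nbhs y (~` closure V).
    apply: open_nbhs_nbhs; split; first exact/closed_openC/closed_closure.
    by move=> /VD.
  apply: filterS => z nVz; apply/eqP/negPn/negP => /fV[_ /subset_closure].
  exact: nVz.
apply: filterS2 (near_chart phix b1) (near_chart_dom phix) => y b1y phiy.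
by rewrite /f asboolT// b1y mul1r.
Qed.

Lemma chart_functions_differential : is_differential_structure C.
Proof.
have Ccont f : C f -> continuous f.
  move=> Cf x; have [phi [_ phix] ff] := Cf x.
  exact: factors_near_continuous ff.
split.
- exists (cst 0) => x; have [phi Aphi phix] := atlas_chart_at x.
  by exists phi => //; exists (cst 0); [exact: smooth_cst|exact: nearW].
- move=> B; split=> [oB|]; last exact: coarsest_open_min.
  apply: coarsest_open_separating => x Bx.
  have [phi Aphi phix] := atlas_chart_at x.
  (* The extension of 1 is nonzero at [x] and supported in [B]. *)
  have [f [Cf f1 fB]] := chart_extension Aphi phix
    (open_nbhs_nbhs (conj oB Bx)) (@smooth_cst _ _ 1).
  by exists f; split=> //; rewrite (nbhs_singleton f1) oner_eq0.
- move=> k f G Cf sG x; have [phi Aphi phix] := atlas_chart_at x.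
  exists phi => //; apply: factors_near_comp => // i.
  exact: chart_functions_factor.
- move=> f lf x; have [U [g [xU Cg fg]]] := lf x.
  have [phi [Aphi phix] [h sh gh]] := Cg x.
  exists phi => //; exists h => //.
  by apply: filterS2 (open_nbhs_nbhs xU) gh => y Uy <-; apply: fg; rewrite inE.
Qed.

(** The charts of the atlas are smooth charts, their coordinates being locally
    global functions by [chart_extension]; maximality of the atlas gives the
    equality. *)
Lemma smooth_charts_chart_functions : smooth_charts C = A.
Proof.
apply: (atlas_maximal hA).
  exact/smooth_charts_compatible.
move=> phi Aphi x phix; split=> [i|f Cf]; last exact: chart_functions_factor.
have [f [Cf fE _]] := chart_extension Aphi phix filterT (@smooth_coord _ _ i).
by exists f => //; apply: filterS fE => y ->.
Qed.

End AtlasFunctions.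

(** * Charts as diffeomorphisms onto subspaces of R^n *)

Section ChartDiffeomorphism.
Context {R : realType} {S : topologicalType} (C : set (S -> R)).
Hypothesis hC : is_differential_structure C.

(** Subspace functions are defined by germs, so each of the two directions is
    one of the two conditions that define a smooth chart. *)
Lemma smooth_chart_diffeomorphism phi : smooth_charts C phi ->
  exists Phi : chart_dom phi -> phi @` chart_dom phi,
    diffeomorphism (subspace_functions C (Y := chart_dom phi))
      (subspace_functions (@smooth_functions R _) (Y := phi @` chart_dom phi))
      Phi.
Proof.
move=> sphi.
have domP (u : chart_dom phi) : chart_dom phi (\val u).
  exact: set_mem (valP u).
pose Phi (u : chart_dom phi) : (phi @` chart_dom phi) :=
  exist _ (phi (\val u)) (mem_set (ex_intro2 _ _ (\val u) (domP u) erefl)).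
have /choice[psi psiP] (q : phi @` chart_dom phi) : exists u, Phi u = q.
  have [y phiy yq] := set_mem (valP q).
  by exists (exist _ y (mem_set phiy)); exact: val_inj.
have [g0 _ gK] := chart_inverse phi.
have PhiI : injective Phi.
  move=> u v /(congr1 \val)/= uv; apply: val_inj.
  by rewrite -(gK (\val u)) ?(valP u)// -(gK (\val v)) ?(valP v)// uv.
exists Phi; split=> [h hh u|].
  have [W [g [[oW Wu] sg hg]]] := hh (Phi u).
  have phiu := domP u.
  have [f Cf fE] : locally_in C (fun y => g (phi y)) (\val u).
    apply: (@factors_near_locally _ _ _ hC _ phi).
      by exists g => //; exact: nearW.
    exact: (sphi _ phiu).1.
  have := near_chart phiu (open_nbhs_nbhs (conj oW Wu)).
  move=> /(filterI fE); rewrite nbhsE => -[V oV VE].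
  exists V, f; split=> // v /VE[vE Wv].
  by rewrite -vE /=; exact: hg.
exists psi; split=> [u|q|h hh q].
- by apply: PhiI; rewrite psiP.
- exact: psiP.
have phiu := domP (psi q).
have [V [f [xV Cf hf]]] := hh (psi q).
have [g sg fg] := (sphi _ phiu).2 f Cf.
have [W xW WE] := chart_image_nbhs phiu (filterI (open_nbhs_nbhs xV) fg).
have qE p : \val p = phi (\val (psi p)) by rewrite -{1}(psiP p).
exists W, g; split=> // [|p Wp]; first by rewrite qE.
have [Vp fp] : V (\val (psi p)) /\ f (\val (psi p)) = g (phi (\val (psi p))).
  by apply: WE; [exact: domP|rewrite -qE].
by rewrite /= (hf (psi p) Vp) fp -qE.
Qed.

Lemma continuous_row n (h : S -> 'rV[R]_n) x :
  (forall i, {for x, continuous (fun y => h y ord0 i)}) ->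
  {for x, continuous h}.
Proof.
move=> ch N [P Pn PN]; rewrite /= nbhs_simpl.
have : \forall y \near x, forall i, P ord0 i (h y ord0 i).
  by apply: filter_forall => i; exact: ch i _ (Pn ord0 i).
by apply: filterS => y Py; apply: PN => i j; rewrite ord1.
Qed.

(** The chart is continuous because its coordinates are locally in [C], and its
    inverse is because the functions of [C] composed with it are locally smooth
    on R^n. *)
Lemma diffeomorphism_smooth_chart (U : set S) n (Y : set 'rV[R]_n)
    (Phi : U -> Y) :
  open U ->
  diffeomorphism (subspace_functions C (Y := U))
    (subspace_functions (@smooth_functions R n) (Y := Y)) Phi ->
  forall x, U x -> exists2 phi, smooth_charts C phi & chart_dom phi x.
Proof.
move=> oU [sPhi [Psi [PhiK PsiK sPsi]]] x0 Ux0.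
pose inU y (Uy : U y) : U := exist _ y (mem_set Uy).
(* [m] and [inv] are [Phi] and [Psi] as total functions between the ambient
   spaces; [x0] only serves as a default value. *)
pose m y : 'rV[R]_n :=
  if pselect (U y) is left Uy then \val (Phi (inU y Uy)) else 0.
pose inv q : S := if pselect (Y q) is left Yq then
  \val (Psi (exist _ q (mem_set Yq))) else x0.
have mE (u : U) : m (\val u) = \val (Phi u).
  rewrite /m; case: pselect => [Uu|]; last by case; exact: set_mem (valP u).
  by congr (\val (Phi _)); exact: val_inj.
have invE (q : Y) : inv (\val q) = \val (Psi q).
  rewrite /inv; case: pselect => [Yq|]; last by case; exact: set_mem (valP q).
  by congr (\val (Psi _)); exact: val_inj.
have mK : {in U, cancel m inv}.
  by move=> y Uy; rewrite -[y]/(\val (exist _ y Uy : U)) mE invE PhiK.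
have nearU y : U y -> \forall z \near y, U z.
  by move=> Uy; exact: open_nbhs_nbhs.
have m_loc y i : U y -> locally_in C (fun z => m z ord0 i) y.
  move=> Uy; have /sPhi/(_ (inU y Uy))[V [g [yV Cg gE]]] : subspace_functions
      (@smooth_functions R n) (Y := Y) (fun q => (\val q) ord0 i).
    move=> q; exists setT, (fun p : 'rV[R]_n => p ord0 i); split=> //.
      by split; first exact: openT.
    exact: smooth_coord.
  exists g => //; apply: filterS2 (nearU y Uy) (open_nbhs_nbhs yV) => z Uz Vz.
  by rewrite -[z]/(\val (inU z Uz)) mE -gE.
have cm y : U y -> {for y, continuous m}.
  move=> Uy; apply: continuous_row => i; have [g Cg mg] := m_loc y i Uy.
  move=> N; rewrite /= (nbhs_singleton mg) => /(differential_continuous hC Cg).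
  by apply: filterS2 mg => z /= ->.
have f_loc f y : C f -> U y -> exists2 g : 'rV[R]_n -> R, smooth g &
    \forall q \near m y, Y q -> f (inv q) = g q.
  move=> Cf Uy; have /sPsi/(_ (Phi (inU y Uy)))[W [g [yW sg gE]]] :
      subspace_functions C (Y := U) (fun u => f (\val u)).
    by move=> u; exists setT, f; split=> //; split; first exact: openT.
  exists g => //; rewrite -[y]/(\val (inU y Uy)) mE.
  apply: filterS (open_nbhs_nbhs yW) => q Wq Yq.
  pose q' : Y := exist _ q (mem_set Yq).
  by rewrite -[q]/(\val q') invE; exact: gE.
have mY y : U y -> Y (m y).
  by move=> Uy; rewrite -[y]/(\val (inU y Uy)) mE; exact: set_mem (valP _).
have cm' : {within U, continuous m}.
  apply/subspace_continuousP => y Uy N /(cm y Uy) N'.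
  have {}N' : \forall z \near y, N (m z) by exact: N'.
  have : \forall z \near y, U z -> N (m z) by apply: filterS N'.
  by [].
have cinv : {within m @` U, continuous inv}.
  apply/subspace_continuousP => _ [y Uy <-].
  apply: cvg_differential_structure hC _ _ => f Cf.
  have [g sg gE] := f_loc f y Cf Uy.
  rewrite (nbhs_singleton gE); last exact: mY.
  move=> N /(sg 0%N (m y)) N'.
  have : \forall q \near m y, (m @` U) q -> N (f (inv q)).
    by apply: filterS2 gE N' => q gq Nq [z Uz zq]; rewrite gq// -zq; exact: mY.
  by [].
have mout y : ~ U y -> m y = 0 by rewrite /m; case: pselect.
pose phi := Chart oU cm' (ex_intro2 _ _ inv cinv mK) mout.
exists phi => // y Uy.
split=> [i|f Cf]; first exact: m_loc.
have [g sg gE] := f_loc f y Cf Uy; exists g => //=.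
have := cm y Uy _ gE.
apply: filterS2 (nearU y Uy) => z Uz /= zE.
by rewrite -zE ?mK ?inE//; exact: mY.
Qed.

End ChartDiffeomorphism.

(** * Morphisms and objects *)

Section Morphisms.
Context {R : realType}.

(** For the converse, the coordinates of a chart around [F x] are locally
    global functions, which [F] pulls back to functions that factor through a
    chart around [x]; that chart is then shrunk until all the germs involved are
    equalities on its domain. *)
Lemma atlas_smoothP (X Y : atlas_space R) (F : X -> Y) :
  atlas_smooth F <->
  functionally_smooth (chart_functions (atlas X)) (chart_functions (atlas Y)) F.
Proof.
have [aX aY] := (atlasP X, atlasP Y).
have dX := chart_functions_differential aX (atlas_admissible X).
have dY := chart_functions_differential aY (atlas_admissible Y).
split=> [[cF lF] f Cf x|sF].
  have [phi [psi [[Aphi phix] [Apsi psix] FD [z sz zE]]]] := lF x.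
  have [g sg fg] := chart_functions_factor aY Cf Apsi psix.
  exists phi => //; exists (g \o z); first exact: smooth_compR.
  have : \forall y \near x, f (F y) = g (psi (F y)) by exact: (cF x _ fg).
  by apply: filterS2 (near_chart_dom phix) => y phiy /= ->; rewrite zE.
have cF : continuous F.
  move=> x; apply: cvg_differential_structure dY _ _ => f Cf.
  exact: (differential_continuous dX (sF f Cf)).
split=> // x.
have [phi Aphi phix] := atlas_chart_at aX x.
have [psi Apsi psix] := atlas_chart_at aY (F x).
have spsi : smooth_charts (chart_functions (atlas Y)) psi.
  by rewrite (smooth_charts_chart_functions aY (atlas_admissible Y)).
have ff i : factors_near (fun y => psi (F y) ord0 i) phi x.
  have [g Cg pg] := (spsi _ psix).1 i.
  have [h sh gh] := chart_functions_factor aX (sF g Cg) Aphi phix.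
  exists h => //.
  have : \forall y \near x, psi (F y) ord0 i = g (F y) by exact: (cF x _ pg).
  by apply: filterS2 gh => y /= <-.
have [z sz zE] := factors_near_row ff.
have nF : \forall y \near x, chart_dom psi (F y).
  exact: (cF x _ (near_chart_dom psix)).
have : nbhs x [set y | chart_dom psi (F y) /\
    \row_i psi (F y) ord0 i = z (phi y)] by exact: filterI nF zE.
rewrite nbhsE => -[U [oU Ux] UE].
exists (chart_restrict phi oU), psi; split=> //.
- by split; [exact: atlas_restrict|].
- by move=> _ [y [_ /UE[psiFy _]] <-].
- exists z => // y phiy; rewrite /= chart_restrictE//.
  by case: phiy => _ /UE[_ <-]; rewrite row_coord.
Qed.

Lemma chart_functions_euclidean (X : atlas_space R) :
  locally_euclidean_subspace (chart_functions (atlas X)).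
Proof.
have aX := atlasP X; have sX := atlas_admissible X.
move=> x; have [phi Aphi phix] := atlas_chart_at aX x.
have dX := chart_functions_differential aX sX.
have : smooth_charts (chart_functions (atlas X)) phi.
  by rewrite smooth_charts_chart_functions.
move=> /(smooth_chart_diffeomorphism dX)[Phi dPhi].
exists (chart_dom phi); first by split=> //; exact: chart_open.
by exists (chart_dim phi), (phi @` chart_dom phi), Phi.
Qed.

Definition to_subcartesian (X : atlas_space R) : subcartesian_space R :=
  @SubcartesianSpace R X (chart_functions (atlas X)) (atlas_admissible X)
    (chart_functions_differential (atlasP X) (atlas_admissible X))
    (@chart_functions_euclidean X).

Lemma smooth_charts_cover (Y : subcartesian_space R) :
  \bigcup_(phi in smooth_charts (subcart_functions Y)) chart_dom phi = [set: Y].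
Proof.
rewrite -subTset => x _.
have [U [oU Ux] [n [D [Phi dPhi]]]] := @subcart_local R Y x.
have [phi] := diffeomorphism_smooth_chart (subcart_diff Y) oU dPhi Ux.
by exists phi.
Qed.

Lemma smooth_charts_atlas (Y : subcartesian_space R) :
  is_atlas (smooth_charts (subcart_functions Y)).
Proof.
have dY := subcart_diff Y; have cY := smooth_charts_cover Y; split=> //.
  exact: smooth_charts_compatible.
exact: smooth_charts_maximal.
Qed.

Definition to_atlas (Y : subcartesian_space R) : atlas_space R :=
  @AtlasSpace R Y (smooth_charts (subcart_functions Y)) (subcart_admissible Y)
    (smooth_charts_atlas Y).

Lemma atlas_subcart_smooth (X Y : atlas_space R) (F : X -> Y) :
  atlas_smooth F -> @subcart_smooth R (to_subcartesian X) (to_subcartesian Y) F.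
Proof. by move/atlas_smoothP. Qed.

Lemma subcart_atlas_smooth (X Y : subcartesian_space R) (F : X -> Y) :
  subcart_smooth F -> @atlas_smooth R (to_atlas X) (to_atlas Y) F.
Proof.
move=> sF; apply/atlas_smoothP => /=.
by rewrite !chart_functions_smooth_charts//; try exact: subcart_diff;
  exact: smooth_charts_cover.
Qed.

Lemma atlas_space_eq (T : topologicalType) (A B : set (chart R T)) sA sB aA aB :
  A = B -> @AtlasSpace R T A sA aA = @AtlasSpace R T B sB aB.
Proof. by move=> E; subst B; congr AtlasSpace; exact: Prop_irrelevance. Qed.

Lemma subcartesian_space_eq (T : topologicalType) (C D : set (T -> R))
    sC sD dC dD lC lD :
  C = D ->
  @SubcartesianSpace R T C sC dC lC = @SubcartesianSpace R T D sD dD lD.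
Proof.
by move=> E; subst D; congr SubcartesianSpace; exact: Prop_irrelevance.
Qed.

Lemma to_subcartesianK : cancel to_subcartesian to_atlas.
Proof.
case=> T A sT aT; apply: atlas_space_eq.
exact: smooth_charts_chart_functions.
Qed.

Lemma to_atlasK : cancel to_atlas to_subcartesian.
Proof.
case=> T C sT dC lC; apply: subcartesian_space_eq.
apply: chart_functions_smooth_charts => //.
exact: smooth_charts_cover (SubcartesianSpace sT dC lC).
Qed.

End Morphisms.

(** * The isomorphism of categories *)

Section ConcreteFunctors.

(** Morphisms of [E a] and of [a] have different types, hence the transports;
    the proof of equality of the objects may be any one by proof irrelevance. *)
Lemma functor_eq_id (C : category) (E : functor C C) (e : forall a, E a = a) :
  (forall (a b : C) (f : hom a b),
    eq_rect _ (fun z => hom z b)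
      (eq_rect _ (hom (E a)) (fmap E f) _ (e b)) _ (e a) = f) ->
  E = functor_id C.
Proof.
case: E e => Eo Em Eid Ec /= e H.
have Eo_id : Eo = idfun by apply/funext.
subst Eo.
have eI a : e a = erefl by exact: Prop_irrelevance.
have Em_id : Em = fun _ _ f => f.
  apply: functional_extensionality_dep => a.
  apply: functional_extensionality_dep => b.
  by apply/funext => f; rewrite -[RHS]H !eI.
subst Em; congr Functor; exact: Prop_irrelevance.
Qed.

Context (O : Type) (T : O -> Type) (P : forall X Y, (T X -> T Y) -> Prop).

(** Transporting a morphism of a concrete category conjugates its underlying map
    by the transports of the carriers; these are identities between convertible
    carriers, by [eq_rect_refl]. *)
Lemma sval_transport X Y X' Y' (eX : X' = X) (eY : Y' = Y)
    (f : {f : T X' -> T Y' | P f}) (x : T X) :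
  sval (eq_rect _ (fun Z => {f : T Z -> T Y | P f})
    (eq_rect _ (fun Z => {f : T X' -> T Z | P f}) f _ eY) _ eX) x =
  eq_rect _ id (sval f (eq_rect _ id x _ (congr1 T (esym eX)))) _ (congr1 T eY).
Proof. by subst X Y. Qed.

Lemma eq_rect_refl (A : Type) (e : A = A) (x : A) : eq_rect A id x A e = x.
Proof. by rewrite (Prop_irrelevance e erefl). Qed.

End ConcreteFunctors.

Section Functors.
Context (R : realType).

Definition atlas_to_subcartesian_hom (X Y : atlas_category R) (f : hom X Y) :
    @hom (subcartesian_category R) (to_subcartesian X) (to_subcartesian Y) :=
  exist _ (sval f) (atlas_subcart_smooth (svalP f)).

Definition atlas_to_subcartesian :
  functor (atlas_category R) (subcartesian_category R).
Proof.
by apply: (@Functor (atlas_category R) (subcartesian_category R) _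
  atlas_to_subcartesian_hom) => *; exact: sig_eq.
Defined.

Definition subcartesian_to_atlas_hom (X Y : subcartesian_category R)
    (f : hom X Y) : @hom (atlas_category R) (to_atlas X) (to_atlas Y) :=
  exist _ (sval f) (subcart_atlas_smooth (svalP f)).

Definition subcartesian_to_atlas :
  functor (subcartesian_category R) (atlas_category R).
Proof.
by apply: (@Functor (subcartesian_category R) (atlas_category R) _
  subcartesian_to_atlas_hom) => *; exact: sig_eq.
Defined.

End Functors.

Theorem theorem6p3 (R : realType) :
  isomorphic_categories (atlas_category R) (subcartesian_category R).
Proof.
exists (atlas_to_subcartesian R), (subcartesian_to_atlas R); split.
- apply: (@functor_eq_id (atlas_category R)
    (functor_comp (subcartesian_to_atlas R) (atlas_to_subcartesian R))
    (@to_subcartesianK R)) => X Y f.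
  apply: sig_eq; apply/funext => x.
  rewrite [LHS](@sval_transport (atlas_space R) (fun X => X)
    (@atlas_smooth R)).
  by rewrite !eq_rect_refl.
- apply: (@functor_eq_id (subcartesian_category R)
    (functor_comp (atlas_to_subcartesian R) (subcartesian_to_atlas R))
    (@to_atlasK R)) => X Y f.
  apply: sig_eq; apply/funext => x.
  rewrite [LHS](@sval_transport (subcartesian_space R) (fun X => X)
    (@subcart_smooth R)).
  by rewrite !eq_rect_refl.
Qed.
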